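(* Assume the conditions Consistency, Compactness–continuity, Costly impulses and Orbit condition (all stated in the context). Let $\mu$ be a finite measure on $V\times\bar{\mathbb R}^0_+\times{\bf A}$, concentrated on ${\bf M}\times{\bf A}$ and satisfying $$\mu(\Gamma\times\bar{\mathbb R}^0_+\times{\bf A})=\delta_{x_0}(\Gamma)+\int_{V\times\mathbb R^0_+\times{\bf A}}\mathbb I\{l(\phi(y,\theta),a)\in\Gamma\}\,\mu(dy\times d\theta\times da),\qquad \Gamma\in{\cal B}(V).$$ Then the aggregated occupation measure $\eta$ on $V\times{\bf A}_\Box$ induced by $\mu$ satisfies, for all functions $w\in{\bf W}$, $$w(x_0)+\int_{V}\chi w(x)\,\eta(dx\times\Box)-\int_{V}w(x)\,\eta(dx\times{\bf A})+\int_{V\times{\bf A}}w(l(x,a))\,\eta(dx\times da)=0,$$ and all the integrals in this equation are finite.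
   Context: Conventions. $\mathbb R^0_+=[0,\infty)$, $\bar{\mathbb R}^0_+=[0,\infty]$. ''Positive, negative, increasing, decreasing'' are in the non-strict sense. A measure is a countably additive $[0,\infty]$-valued set function vanishing on $\emptyset$. $\mathbb I$ is the indicator, $\delta_y$ the Dirac measure, $\inf\emptyset=+\infty$; Lebesgue integrals over $[0,\infty]$ are over $(0,\infty)$. Model. $\tilde{\bf X}$ is a Borel space with compatible metric $\tilde\rho$; $\tilde\phi:\tilde{\bf X}\times\mathbb R^0_+\to\tilde{\bf X}$ is a measurable flow: $\tilde\phi(\tilde x,0)=\tilde x$, $\tilde\phi(\tilde x,t+s)=\tilde\phi(\tilde\phi(\tilde x,s),t)$. The state space is ${\bf X}=\{(\tilde y,t)\in\tilde{\bf X}\times\mathbb R^0_+:\ \tilde y=\tilde\phi(\tilde x,t)\text{ for some }\tilde x\in\tilde{\bf X}\}$ with the topology induced from the product topology and its Borel $\sigma$-algebra, and $\phi((\tilde x,t),u)=(\tilde\phi(\tilde x,u),t+u)$. ${\bf A}$ (actions) is a Borel space; $l(x,a)=(\tilde l(x,a),0)$ with $\tilde l:{\bf X}\times{\bf A}\to\tilde{\bf X}$ measurable. For $j=0,\dots,J$, $C^g_j:{\bf X}\to\mathbb R^0_+$ and $C^I_j:{\bf X}\times{\bf A}\to\mathbb R^0_+$ are measurable; $d_1,\dots,d_J\in\mathbb R^0_+$; $x_0=(\tilde x_0,0)$ is a fixed initial state. ${\bf X}_\Delta={\bf X}\cup\{\Delta\}$ with $\Delta$ isolated; ${\bf B}=\bar{\mathbb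 R}^0_+\times{\bf A}$. Strategies. A strategy $\pi=\{\pi_i\}_{i\ge1}$ is a sequence of stochastic kernels $\pi_i$ on ${\bf B}$ given histories $(x_0,b_1,x_1,\dots,b_{i-1},x_{i-1})$, $b_k=(\theta_k,a_k)$. $P^\pi_{x_0}$ is the law (expectation $E^\pi_{x_0}$) of $X_0=x_0,B_1=(\Theta_1,A_1),X_1,\dots$ where $B_i$ has conditional law $\pi_i$ given the history, and $X_i=l(\phi(X_{i-1},\Theta_i),A_i)$ if $X_{i-1}\in{\bf X}$, $\Theta_i<\infty$, and $X_i=\Delta$ otherwise. Put ${\cal V}_j(x_0,\pi)=E^\pi_{x_0}\big[\sum_{i\ge1}\mathbb I\{X_{i-1}\ne\Delta\}\{\int_{[0,\Theta_i]}C^g_j(\phi(X_{i-1},u))du+\mathbb I\{\Theta_i<\infty\}C^I_j(\phi(X_{i-1},\Theta_i),A_i)\}\big]$. Conditions. Consistency: there is a strategy $\pi$ with ${\cal V}_j(x_0,\pi)\le d_j$ for $j=1,\dots,J$ and ${\cal V}_0(x_0,\pi)<\infty$. Compactness–continuity: ${\bf A}$ is compact, $\bar{\mathbb R}^0_+$ is the one-point compactification of $\mathbb R^0_+$; $l$ is continuous on ${\bf X}\times{\bf A}$; $\phi$ is continuous on ${\bf X}\times\mathbb R^0_+$; all $C^I_j$ and $C^g_j$ are lower semicontinuous. Costly impulses: there is $\delta>0$ with $\sum_{j=0}^JC^I_j(x,a)\ge\delta$ for all $(x,a)\in{\bf X}\times{\bf A}$. Orbit condition: for distinct $\tilde x_1,\tilde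 x_2\in\tilde{\bf X}$ the orbits $\{\phi((\tilde x_k,0),t):t\in\mathbb R^0_+\}$, $k=1,2$, are disjoint (so for $y=(\tilde y,t)\in{\bf X}$ there is a unique $h(y)\in\tilde{\bf X}$ with $\tilde y=\tilde\phi(h(y),t)$); $\tilde\phi,\phi$ are continuous; and there is $d:\mathbb R^0_+\to(0,\infty)$, bounded on every $[0,T]$, with $\tilde\rho(h(y_1),h(y_2))\le(d(t_1)\vee d(t_2))\rho(y_1,y_2)$ for all $y_k=(\tilde y_k,t_k)\in{\bf X}$, where $\rho$ is a compatible metric on $\tilde{\bf X}\times\mathbb R^0_+$. (Under the Orbit condition, ${\bf X}$ is a Borel space.) The set $V$. $V=\{x\in{\bf X}:\int_{[0,\infty)}\sum_{j=0}^JC^g_j(\phi(x,u))du>0\}$, $V^c={\bf X}_\Delta\setminus V$, $\tilde V=\{\tilde x\in\tilde{\bf X}:(\tilde x,0)\in V\}$, $\tilde\theta^*(\tilde x)=\inf\{\theta\in\mathbb R^0_+:\phi((\tilde x,0),\theta)\in V^c\}$, and ${\bf M}=\{((\tilde x,0),\theta):\tilde x\in\tilde V,\ \theta\in[0,\tilde\theta^*(\tilde x))\cup\{\infty\}\}$. Aggregated occupation measure. ${\bf A}_\Box={\bf A}\cup\{\Box\}$, $\Box$ an isolated point. For a measure $\mu$ on $V\times\bar{\mathbb R}^0_+\times{\bf A}$, the induced aggregated occupation measure $\eta$ on $V\times{\bf A}_\Box$ is given, for $\Gamma_X\in{\cal B}(V)$, $\Gamma_A\in{\cal B}({\bf A})$,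 by $\eta(\Gamma_X\times\Box)=\int_{\mathbb R^0_+}\{\int_V\mathbb I\{\phi(x,u)\in\Gamma_X\}\mu(dx\times[u,\infty]\times{\bf A})\}du$ and $\eta(\Gamma_X\times\Gamma_A)=\int_{V\times\mathbb R^0_+\times\Gamma_A}\mathbb I\{\phi(x,\theta)\in\Gamma_X\}\mu(dx\times d\theta\times da)$. Test functions. ${\bf W}$ is the set of bounded measurable $w:{\bf X}\to\mathbb R$ such that for every $x\in{\bf X}$ the function $t\mapsto w(\phi(x,t))$ is absolutely continuous; either $w$ is negative and all these functions are increasing, or $w$ is positive and all these functions are decreasing; $w(y)=0$ for $y\in V^c\cap{\bf X}$; and $\lim_{t\to\infty}w(\phi(x,t))=0$ for every $x\in V$ with $\phi(x,t)\in V$ for all $t\ge0$. For $w\in{\bf W}$, $\chi w(x)=\lim_{n\to\infty}n[w(\phi(x,1/n))-w(x)]$ if this limit exists and is finite, $\chi w(x)=0$ otherwise; it is measurable and $w(\phi(x,t))-w(x)=\int_{[0,t]}\chi w(\phi(x,s))ds$. *)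

(* Defs.v *)
From HB Require Import structures.
From mathcomp Require Import all_boot all_order all_algebra.
From mathcomp Require Import all_classical all_reals all_analysis.
From mathcomp Require Import measurable_realfun.

Set Implicit Arguments.
Unset Strict Implicit.
Unset Printing Implicit Defensive.

Import Order.TTheory GRing.Theory Num.Theory.
Import numFieldNormedType.Exports.

Local Open Scope classical_set_scope.
Local Open Scope ring_scope.

(* The carrier of T equipped with its Borel sigma-algebra. *)
Notation borel T := (g_sigma_algebraType (@open T)).

#[short(type="pmetricType")]
HB.structure Definition PointedMetric (K : numDomainType) :=
  {T of Metric K T & Pointed T}.

(* T is homeomorphic to a Borel subset of a Polish space P. *)
Definition borel_space (R : realType) (T : topologicalType) : Prop :=
  exists (P : completePseudoMetricType R) (f : T -> P),
    [/\ hausdorff_space P,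
        exists2 D : set P, countable D & dense D,
        injective f,
        forall U : set T, open U <-> exists2 W : set P, open W & U = f @^-1` W &
        <<s @open P >> (range f)].

(* rho is a metric on S inducing the subspace topology of S. *)
Definition compatible_metric_on (R : realType) (T : topologicalType)
    (S : set T) (rho : T -> T -> R) : Prop :=
  [/\ {in S &, forall p q, 0 <= rho p q},
      {in S &, forall p q, rho p q = 0 <-> p = q},
      {in S &, forall p q, rho p q = rho q p},
      {in S & &, forall p q r, rho p r <= rho p q + rho q r} &
      forall p, S p -> forall U : set T,
        within S (nbhs p) U <->
        exists2 e : R, 0 < e & forall q, S q -> rho p q < e -> U q].

Definition absolutely_continuous_on (R : realType) (a b : R) (f : R -> R) : Prop :=
  forall e : R, 0 < e -> exists2 d : R, 0 < d &
    forall (n : nat) (s t : 'I_n -> R),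
      (forall i, a <= s i /\ s i <= t i /\ t i <= b) ->
      (forall i j, i != j -> t i <= s j \/ t j <= s i) ->
      \sum_i (t i - s i) < d -> \sum_i `|f (t i) - f (s i)| < e.

(* T with one isolated point None added: a set is open iff its trace on T is. *)
Definition adjoin (T : Type) : Type := option T.

Section adjoin_topology.
Variable T : topologicalType.

Let op : set_system (adjoin T) := [set U | open (Some @^-1` U)].

Let opT : op setT.
Proof. by rewrite /op /= preimage_setT; exact: openT. Qed.

Let opI : setI_closed op.
Proof. by move=> U W; rewrite /op /= preimage_setI; exact: openI. Qed.

Let op_bigU (I : Type) (f : I -> set (adjoin T)) :
  (forall i, op (f i)) -> op (\bigcup_i f i).
Proof.
by move=> fo; rewrite /op /= preimage_bigcup; apply: bigcup_open => i _; exact: fo.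
Qed.

HB.instance Definition _ := Choice.copy (adjoin T) (option T).
HB.instance Definition _ := isOpenTopological.Build (adjoin T) opT opI op_bigU.
HB.instance Definition _ := isPointed.Build (adjoin T) None.

End adjoin_topology.

(* Sequences with the sigma-algebra generated by the coordinates. *)
Definition cylinders d (T : measurableType d) : set_system (nat -> T) :=
  \bigcup_n preimage_set_system setT (fun w : nat -> T => w n) measurable.

Notation sequence_space T :=
  (g_sigma_algebraType (@cylinders _ [the measurableType _ of T])).

Section state_space.
Variable R : realType.

(* Times in [0, +oo[ are reals t with 0 <= t; the values of a flow at
   negative times are irrelevant. *)
Record flow (Xt : pmetricType R) := Flow {
  flow_fun :> Xt -> R -> Xt;
  flow_measurable : measurable_fun
    [set p : borel Xt * R | 0 <= p.2] (fun p => flow_fun p.1 p.2 : borel Xt);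
  flow0 : forall x, flow_fun x 0 = x;
  flowD : forall x t s, 0 <= t -> 0 <= s ->
    flow_fun x (t + s) = flow_fun (flow_fun x s) t }.

Variables (Xt : pmetricType R) (f : flow Xt).

Definition state_set : set (Xt * R) :=
  [set y | 0 <= y.2 /\ exists x, y.1 = f x y.2].

Definition state : Type := set_type state_set.

Lemma start_subproof x : (x, 0) \in state_set.
Proof. by apply/mem_set; split => //; exists x; rewrite /= flow0. Qed.

Definition start (x : Xt) : state := SigSub (start_subproof x).

(* The state (x, t) moved along the flow during time u; negative u is
   truncated to 0 so that the result is a state. *)
Lemma move_subproof (y : state) (u : R) :
  (f (val y).1 (Num.max u 0), (val y).2 + Num.max u 0) \in state_set.
Proof.
have u0 : 0 <= Num.max u 0 by rewrite le_max lexx orbT.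
apply/mem_set; have [y0 [x yx]] := set_valP y.
by split; [exact: addr_ge0|exists x => /=; rewrite yx -flowD// addrC].
Qed.

Definition move (y : state) (u : R) : state := SigSub (move_subproof y u).

End state_space.

HB.instance Definition _ (R : realType) (Xt : pmetricType R) (f : flow Xt) :=
  Topological.copy (state f) (set_type (state_set f)).
HB.instance Definition _ (R : realType) (Xt : pmetricType R) (f : flow Xt) :=
  isPointed.Build (state f) (start f point).

Record model (R : realType) := Model {
  base : pmetricType R;
  base_borel : borel_space R base;
  action : ptopologicalType;
  action_borel : borel_space R action;
  base_flow : flow base;
  base_jump : state base_flow -> action -> base;
  base_jump_measurable : measurable_fun setT
    (fun p : borel (state base_flow) * borel action =>
       base_jump p.1 p.2 : borel base);
  ncost : nat;
  Cg : 'I_ncost.+1 -> state base_flow -> R;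
  Cg_ge0 : forall j x, 0 <= Cg j x;
  Cg_measurable : forall j,
    measurable_fun setT (Cg j : borel (state base_flow) -> R);
  CI : 'I_ncost.+1 -> state base_flow -> action -> R;
  CI_ge0 : forall j x a, 0 <= CI j x a;
  CI_measurable : forall j, measurable_fun setT
    (fun p : borel (state base_flow) * borel action => CI j p.1 p.2);
  (* the bound on the cost of index [lift ord0 j], which ranges over 1..ncost *)
  bound : 'I_ncost -> R;
  bound_ge0 : forall j, 0 <= bound j;
  base_init : base }.

Notation X M := (state (base_flow M)).

Section decision_process.
Variables (R : realType) (M : model R).

Definition phi (x : X M) (u : R) : X M := move x u.

Definition jump (x : X M) (a : action M) : X M := start (base_flow M) (base_jump x a).

Definition x0 : X M := start (base_flow M) (base_init M).

(* The cemetery point Delta is [None : adjoin X]. Decisions (theta, a) live in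
   \bar R * action; only those with 0 <= theta matter. *)
Local Notation XDelta := (borel (adjoin (X M))).
Local Notation decision := (\bar R * borel (action M))%type.

(* (x_0, [:: (b_1, x_1); ...; (b_n, x_n)]) *)
Local Notation history n := (XDelta * n.-tuple (decision * XDelta)%type)%type.

(* (x_0, n |-> (b_{n+1}, x_{n+1})) *)
Local Notation trajectory :=
  (XDelta * sequence_space (decision * XDelta)%type)%type.

Definition history_of (w : trajectory) (n : nat) : history n :=
  (w.1, [tuple w.2 i | i < n]).

(* X_n, and B_{n+1} *)
Definition state_at (w : trajectory) (n : nat) : XDelta :=
  if n is m.+1 then (w.2 m).2 else w.1.
Definition decision_at (w : trajectory) (n : nat) : decision := (w.2 n).1.

(* [strategy_kernel n] is the kernel pi_{n+1}. *)
Record strategy := Strategy {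
  strategy_kernel :> forall n, R.-pker (history n) ~> decision;
  strategy_time_ge0 : forall n h,
    strategy_kernel n h [set b | (b.1 < 0)%E] = 0%E }.

Definition next_state (x : XDelta) (b : decision) : XDelta :=
  if x is Some y then
    if (b.1 < +oo)%E then Some (jump (phi y (fine b.1)) b.2) else None
  else None.

(* P is the (unique, by the Ionescu-Tulcea theorem) law of the controlled
   process started at x0 under the strategy pi. *)
Definition strategic_measure (pi : strategy) (P : probability trajectory R) : Prop :=
  [/\ {ae P, forall w, state_at w 0 = Some x0},
      forall n (G : set (history n)) (D : set decision),
        measurable G -> measurable D ->
        P [set w | G (history_of w n) /\ D (decision_at w n)] =
        (\int[P]_(w in [set w | G (history_of w n)]) pi n (history_of w n) D)%E &
      {ae P, forall w, forall n,
        state_at w n.+1 = next_state (state_at w n) (decision_at w n)}].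

Definition stage_cost (j : 'I_(ncost M).+1) (x : XDelta) (b : decision) : \bar R :=
  if x is Some y then
    (\int[lebesgue_measure]_(u in [set u : R | (0 <= u)%R /\ u%:E <= b.1])
        (Cg j (phi y u))%:E
     + if b.1 < +oo then (CI j (phi y (fine b.1)) b.2)%:E else 0)%E
  else 0%E.

Definition value (j : 'I_(ncost M).+1) (P : probability trajectory R) : \bar R :=
  (\int[P]_w \sum_(0 <= n <oo) stage_cost j (state_at w n) (decision_at w n))%E.

Definition consistency : Prop :=
  exists (pi : strategy) (P : probability trajectory R),
    [/\ strategic_measure pi P,
        forall j : 'I_(ncost M), (value (lift ord0 j) P <= (bound j)%:E)%E &
        (value ord0 P < +oo)%E].

Definition compactness_continuity : Prop :=
  [/\ compact [set: action M],
      continuous (fun p : X M * action M => jump p.1 p.2),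
      {within [set p : X M * R | 0 <= p.2], continuous (fun p => phi p.1 p.2)},
      forall j, lower_semicontinuous
        (fun p : X M * action M => (CI j p.1 p.2)%:E) &
      forall j, lower_semicontinuous (fun x : X M => (Cg j x)%:E)].

Definition costly_impulses : Prop :=
  exists2 delta : R, 0 < delta &
    forall (x : X M) (a : action M), delta <= \sum_j CI j x a.

Definition flow_orbit (x : base M) : set (X M) :=
  [set phi (start (base_flow M) x) t | t in [set t | 0 <= t]].

(* h(y); unique when distinct orbits are disjoint. *)
Definition origin (y : X M) : base M :=
  get [set x | (val y).1 = base_flow M x (val y).2].

Definition orbit_condition : Prop :=
  [/\ forall x1 x2 : base M, x1 <> x2 -> flow_orbit x1 `&` flow_orbit x2 = set0,
      {within [set p : base M * R | 0 <= p.2],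
        continuous (fun p => base_flow M p.1 p.2)},
      {within [set p : X M * R | 0 <= p.2], continuous (fun p => phi p.1 p.2)} &
      exists (d : R -> R) (rho : base M * R -> base M * R -> R),
        [/\ forall t, 0 <= t -> 0 < d t,
            forall T, 0 <= T -> exists K, forall t, 0 <= t -> t <= T -> d t <= K,
            compatible_metric_on [set p : base M * R | 0 <= p.2] rho &
            forall y1 y2 : X M, mdist (origin y1) (origin y2) <=
              Num.max (d (val y1).2) (d (val y2).2) * rho (val y1) (val y2)]].

Definition V : set (X M) :=
  [set x | (0 < \int[lebesgue_measure]_(u in `[0%R, +oo[)
                  (\sum_j Cg j (phi x u))%R%:E)%E].

Definition theta_star (x : base M) : \bar R :=
  ereal_inf [set t%:E | t in
    [set t : R | 0 <= t /\ ~ V (phi (start (base_flow M) x) t)]].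

Definition active : set (X M * \bar R) :=
  [set p | exists x : base M,
    [/\ p.1 = start (base_flow M) x, V (start (base_flow M) x) &
        ((0 <= p.2)%E /\ (p.2 < theta_star x)%E) \/ p.2 = +oo%E]].

(* A measure on V x [0, +oo] x action (resp. on V x (action + box)) is encoded
   as a measure on X x \bar R x action (resp. on X x adjoin action, where box is
   [None]) for which the complement of that set is negligible. *)
Local Notation impulse_space := (borel (X M) * \bar R * borel (action M))%type.
Local Notation aggregated_space := (borel (X M) * borel (adjoin (action M)))%type.

Definition occupation_equation (mu : {measure set impulse_space -> \bar R}) : Prop :=
  forall G : set (borel (X M)), measurable G -> G `<=` V ->
    mu (G `*` [set theta | (0 <= theta)%E] `*` setT) =
    (\d_(x0 : borel (X M)) G +
     \int[mu]_(z in V `*` [set theta | 0 <= theta < +oo] `*` setT)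
       (\1_G (jump (phi z.1.1 (fine z.1.2)) z.2))%:E)%E.

Definition box_part (G : set (X M)) : set aggregated_space :=
  [set p | G p.1 /\ p.2 = None].

Definition action_part (G : set (X M)) (D : set (action M)) : set aggregated_space :=
  [set p | G p.1 /\ exists2 a, D a & p.2 = Some a].

(* The two formulas determine eta: the part on V x action is finite when mu is. *)
Definition aggregated_occupation_measure
    (mu : {measure set impulse_space -> \bar R})
    (eta : {measure set aggregated_space -> \bar R}) : Prop :=
  [/\ eta.-negligible (~` (V `*` setT)),
      forall G : set (borel (X M)), measurable G -> G `<=` V ->
        eta (box_part G) =
        (\int[lebesgue_measure]_(u in `[0%R, +oo[)
           \int[mu]_(z in V `*` [set theta | u%:E <= theta] `*` setT)
             (\1_G (phi z.1.1 u))%:E)%E &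
      forall (G : set (borel (X M))) (D : set (borel (action M))),
        measurable G -> G `<=` V -> measurable D ->
        eta (action_part G D) =
        (\int[mu]_(z in V `*` [set theta | 0 <= theta < +oo] `*` D)
           (\1_G (phi z.1.1 (fine z.1.2)))%:E)%E].

Record test_function (w : X M -> R) : Prop := TestFunction {
  test_bounded : exists K : R, forall x, `|w x| <= K;
  test_measurable : measurable_fun setT (w : borel (X M) -> R);
  test_ac : forall (x : X M) (T : R), 0 <= T ->
    absolutely_continuous_on 0 T (fun t => w (phi x t));
  test_monotone :
    ((forall x, w x <= 0) /\
     (forall x s t, 0 <= s -> s <= t -> w (phi x s) <= w (phi x t))) \/
    ((forall x, 0 <= w x) /\
     (forall x s t, 0 <= s -> s <= t -> w (phi x t) <= w (phi x s)));
  test_out : forall y, ~ V y -> w y = 0;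
  test_lim : forall x, V x -> (forall t, 0 <= t -> V (phi x t)) ->
    w (phi x t) @[t --> +oo] --> (0 : R) }.

Definition chi (w : X M -> R) (x : X M) : R :=
  let q : R^nat := fun n => n%:R * (w (phi x n%:R^-1) - w x) in
  if `[< cvgn q >] then limn q else 0.

(* The function (x, a) |-> w (l (x, a)), extended by 0 where a is box. *)
Definition after_jump (w : X M -> R) (p : aggregated_space) : R :=
  if p.2 is Some a then w (jump p.1 a) else 0.

End decision_process.

Arguments V {R} M.
Arguments active {R} M.

(* Main.v *)
Require Import Defs.
From HB Require Import structures.
From mathcomp Require Import finmap.
From mathcomp Require Import all_boot all_order all_algebra.
From mathcomp Require Import all_classical all_reals all_analysis.
From mathcomp Require Import measurable_realfun ring lra.

Import Order.TTheory GRing.Theory Num.Theory.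
Import numFieldNormedType.Exports.

Local Open Scope classical_set_scope.
Local Open Scope ring_scope.

(* Up to the sign of w, assume that w is negative and increasing along orbits.
   Along an orbit w is absolutely continuous and monotone, so that its
   Lebesgue-Stieltjes measure has a density with respect to the Lebesgue measure;
   by Lebesgue differentiation this density is chi w almost everywhere.
   Hence, for x in V,
     w(phi(x, theta)) - w(x) = int_0^theta chi w(phi(x, u)) du,
   where w(phi(x, oo)) is read as 0, because chi w and w vanish outside V and an
   orbit never re-enters V. Integrating against mu turns the right-hand
   side into the integral of chi w over V x box, and the term w(phi(x, theta)) into the
   integral of w over V x A; the integral of w(x) is rewritten by the equation for
   mu. All terms have a constant sign and are dominated by the integral of -w
   against mu, which is finite as w is bounded. *)

(** * Densities of monotone absolutely continuous functions *)

Definition absolutely_continuous {R : realType} (g : R -> R) : Prop :=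
  forall e : R, 0 < e -> exists2 d : R, 0 < d &
    forall (n : nat) (s t : 'I_n -> R),
      (forall i, s i <= t i) ->
      (forall i j, i != j -> t i <= s j \/ t j <= s i) ->
      \sum_i (t i - s i) < d -> \sum_i `|g (t i) - g (s i)| < e.

Lemma cvgn_invn {R : realType} : n%:R^-1 @[n --> \oo] --> (0 : R).
Proof. by rewrite -(cvg_shiftS (fun n => n%:R^-1 : R)); exact: cvg_harmonic. Qed.

Lemma cvgn_invn_dnbhs {R : realType} : n%:R^-1 @[n --> \oo] --> (0 : R)^'.
Proof.
move=> P /(cvgn_invn (R := R)) P0.
have {}P0 : \forall n \near \oo, n%:R^-1 != 0 :> R -> P n%:R^-1 by exact: P0.
suff : \forall n \near \oo, P n%:R^-1 by [].
near=> n; have : n%:R^-1 != 0 :> R -> P n%:R^-1 by near: n; exact: P0.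
by apply; rewrite invr_eq0 pnatr_eq0 -lt0n; near: n; exact: nbhs_infty_gt.
Unshelve. all: by end_near. Qed.

Section absolute_continuity.
Context {R : realType}.
Implicit Types (g : R -> R) (a b : R).
Local Notation lambda := (@lebesgue_measure R).

(** Precomposition with this retraction extends a function given on [[a, b]] to the whole line, as
    needed to form a Lebesgue-Stieltjes measure. *)
Definition clamp a b (x : R) : R := Num.max a (Num.min x b).

Lemma clamp_id a b x : a <= x -> x <= b -> clamp a b x = x.
Proof. by move=> ax xb; rewrite /clamp min_l// max_r. Qed.

Lemma clamp_itv a b x : a <= b -> a <= clamp a b x /\ clamp a b x <= b.
Proof.
by move=> ab; rewrite /clamp le_max lexx ge_max ab ge_min lexx orbT.
Qed.

Lemma clamp_homo a b : {homo clamp a b : x y / x <= y}.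
Proof.
by move=> x y xy; rewrite /clamp /Num.max /Num.min; do ! case: ifPn; rewrite -?leNgt; lra.
Qed.

Lemma clamp_lipschitz a b x y : x <= y -> clamp a b y - clamp a b x <= y - x.
Proof.
by move=> xy; rewrite /clamp /Num.max /Num.min; do ! case: ifPn; rewrite -?leNgt; lra.
Qed.

(** The retraction is nondecreasing and 1-Lipschitz, so it keeps intervals non-overlapping and does
    not increase their total length. *)
Lemma absolutely_continuous_clamp a b g : a <= b ->
  absolutely_continuous_on a b g -> absolutely_continuous (g \o clamp a b).
Proof.
move=> ab acg e /acg[d d0 dP]; exists d => // n s t st dis std.
apply: (dP n (clamp a b \o s) (clamp a b \o t)) => [i|i j ij|].
- have [? _] := @clamp_itv a b (s i) ab; have [_ ?] := @clamp_itv a b (t i) ab.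
  by split => //; split => //; apply: clamp_homo.
- by have [?|?] := dis _ _ ij; [left|right]; apply: clamp_homo.
- apply: le_lt_trans std; apply: ler_sum => i _.
  exact: clamp_lipschitz.
Qed.

Lemma absolutely_continuous_continuous g : absolutely_continuous g -> continuous g.
Proof.
move=> acg x; apply/cvgrPdist_lt => e /acg[d d0 dP].
near=> y.
have xyd : `|x - y| < d by near: y; exact: cvgr_dist_lt.
have := dP 1%N (fun=> Num.min x y) (fun=> Num.max x y).
rewrite !big_ord1 /Num.min /Num.max; case: ifPn xyd; rewrite -?leNgt => xy xyd.
  move=> /(_ (fun=> ltW xy)); rewrite distrC; apply.
    by move=> i j; rewrite !ord1.
  by move: xyd; rewrite distrC gtr0_norm ?subr_gt0.
move=> /(_ (fun=> xy)); apply; first by move=> i j; rewrite !ord1.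
by move: xyd; rewrite ger0_norm ?subr_ge0.
Unshelve. all: by end_near. Qed.

Lemma lebesgue_stieltjes_ocitv (g : cumulative R R) (X : set R) : ocitv X ->
  lebesgue_stieltjes_measure g X = wlength g X.
Proof. by move=> oX; rewrite [LHS]measurable_mu_extE. Qed.

Lemma lebesgue_stieltjes_itv (g : cumulative R R) a b : a <= b ->
  lebesgue_stieltjes_measure g `]a, b] = (g b - g a)%:E.
Proof.
move=> ab; rewrite lebesgue_stieltjes_ocitv; last exact: is_ocitv.
by rewrite wlength_itv_bnd.
Qed.

(** By additivity, the Lebesgue and Stieltjes measures of the union are exactly the two sums in the
    definition of absolute continuity. The relation between [e] and [d] is a hypothesis, so that one
    [d] serves all finite unions. *)
Lemma absolutely_continuous_bigcup (g : cumulative R R) (e d : R) (B : set (set R)) :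
  (forall (n : nat) (s t : 'I_n -> R),
      (forall i, s i <= t i) ->
      (forall i j, i != j -> t i <= s j \/ t j <= s i) ->
      \sum_i (t i - s i) < d -> \sum_i `|g (t i) - g (s i)| < e) ->
  finite_set B -> trivIset B id ->
  (forall X, B X -> ocitv X /\ X !=set0) ->
  (lambda (\bigcup_(X in B) X) < d%:E)%E ->
  (lebesgue_stieltjes_measure g (\bigcup_(X in B) X) < e%:E)%E.
Proof.
move=> dP finB triB BP.
have /choice[h hP] : forall X : set R, exists x : R * R,
    B X -> x.1 < x.2 /\ X = `]x.1, x.2]%classic.
  move=> X; have [BX|] := pselect (B X); last by exists (0, 0).
  have [/ocitvP[->|[x xlt ->]] XN0] := BP _ BX; last by exists x.
  by move: XN0 => /set0P; rewrite eqxx.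
have mB X : B X -> measurable (X : set (measurableTypeR R)).
  by move=> /hP[_ ->]; exact: measurable_itv.
(* The formula holds for any cumulative function, so that it applies both to [g] and, with the
   identity, to Lebesgue measure. *)
have sumE (f : cumulative R R) : lebesgue_stieltjes_measure f (\bigcup_(X in B) X) =
    (\sum_(i < size (fset_set B)) (f (h (nth set0 (fset_set B) i)).2
      - f (h (nth set0 (fset_set B) i)).1))%:E.
  rewrite measure_fin_bigcup// fsbig_finite//= (big_nth set0) big_mkord.
  rewrite -sumEFin; apply: eq_bigr => i _.
  have /hP[hlt XE] : B (nth set0 (fset_set B) i).
    by apply/set_mem; rewrite -in_fset_set// mem_nth.
  by rewrite [in LHS]XE lebesgue_stieltjes_itv// ltW.
rewrite /lebesgue_measure !sumE !lte_fin => sumd.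
have ht i : (i < size (fset_set B))%N -> B (nth set0 (fset_set B) i).
  by move=> ilt; apply/set_mem; rewrite -in_fset_set// mem_nth.
under eq_bigr do rewrite -[_ - _]ger0_norm ?subr_ge0
  ?cumulative_is_nondecreasing// ?ltW ?(hP _ (ht _ (ltn_ord _))).1//.
apply: (dP _ (fun i => (h (nth set0 (fset_set B) i)).1)
  (fun i => (h (nth set0 (fset_set B) i)).2)); last exact: sumd.
  by move=> i; exact/ltW/(hP _ (ht _ (ltn_ord _))).1.
move=> i j ij.
have [lti Ei] := hP _ (ht _ (ltn_ord i)).
have [ltj Ej] := hP _ (ht _ (ltn_ord j)).
move: Ei Ej lti ltj; set Xi := nth _ _ i; set Xj := nth _ _ j => Ei Ej lti ltj.
have inX X : X = `](h X).1, (h X).2]%classic -> forall x, (h X).1 < x -> x <= (h X).2 -> X x.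
  move=> XE x hx xh; suff : `](h X).1, (h X).2]%classic x by rewrite -XE.
  by rewrite /= in_itv/= hx.
have [//|tisj] := leP (h Xi).2 (h Xj).1; [by left|right].
(* If the two intervals overlapped, the smaller right endpoint would lie in both; disjointness would
   make them equal, and the enumeration of [B] has no repetition. *)
rewrite leNgt; apply/negP => sitj.
have : Xi = Xj.
  apply: triB; [exact: ht|exact: ht|].
  exists (Num.min (h Xi).2 (h Xj).2); split; apply: inX => //;
    by rewrite ?lt_min ?ge_min ?lti ?ltj ?sitj ?tisj ?lexx ?orbT.
move/eqP; rewrite nth_uniq// ?fset_uniq//.
by move=> /eqP/val_inj ijE; rewrite ijE eqxx in ij.
Qed.

(* A set of Lebesgue measure zero is covered by half-open intervals of small
   total length; each finite union of them is a finite disjoint union of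
   half-open intervals, to which absolute continuity applies. *)
Lemma lebesgue_stieltjes_ac (g : cumulative R R) : absolutely_continuous g ->
  lebesgue_stieltjes_measure g `<< lambda.
Proof.
move=> acg; apply/null_content_dominatesP => A mA A0.
apply/eqP; rewrite eq_le measure_ge0 andbT; apply/lee_addgt0Pr => e e0.
rewrite add0e.
have [d d0 dP] := acg _ e0.
have : (lambda A < d%:E)%E by rewrite A0 lte_fin.
move=> /ereal_inf_lt[_ [F [mF AF] <-] Fd].
pose U n : set R := \bigcup_(k < n) F k.
have mU n : measurable (U n : set (measurableTypeR R)).
  by apply: bigcup_measurable => k _; apply: sub_sigma_algebra; exact: mF.
have mUF : measurable (\bigcup_k F k : set (measurableTypeR R)).
  by apply: bigcup_measurable => k _; apply: sub_sigma_algebra; exact: mF.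
have UF : \bigcup_n U n = \bigcup_k F k.
  apply/seteqP; split => x [k _].
    by move=> [j _ Fjx]; exists j.
  by move=> Fkx; exists k.+1 => //; exists k => /=.
apply: (@le_trans _ _ (lebesgue_stieltjes_measure g (\bigcup_k F k))).
  apply: le_measure; [exact: mem_set|exact: mem_set|exact: AF].
rewrite -UF.
(* Continuity from below: it suffices to bound the measures of the finite unions. *)
have : lebesgue_stieltjes_measure g \o U @ \oo --> lebesgue_stieltjes_measure g (\bigcup_n U n).
  apply: nondecreasing_cvg_mu => //; first by rewrite UF.
  move=> m n mn; apply/subsetPset => x [k km Fkx]; exists k => //=.
  exact: leq_trans mn.
apply: cvge_le; apply: nearW => n /=.
have [B [finB neB triB mB UB]] : exists B : set (set (ocitv_type R)), [/\ finite_set B,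
      (forall X, B X -> X !=set0), trivIset B id,
      (forall X : set (ocitv_type R), X \in B -> measurable X) & U n = \bigcup_(X in B) X].
  apply: SetRing.ring_finite_set; apply: fin_bigcup_measurable => // k _.
  by apply: SetRing.measurable_subring; exact: mF.
rewrite UB ltW// (absolutely_continuous_bigcup g e d B dP)//.
  by move=> X BX; split; [apply: mB; exact: mem_set|exact: neB].
rewrite -UB; apply: le_lt_trans Fd.
apply: (@le_trans _ _ (lambda (\bigcup_k F k))).
  by apply: le_measure; [exact: mem_set|exact: mem_set|rewrite -UF => x Unx; exists n].
apply: le_trans (measure_sigma_subadditive _ _ _ (@subset_refl _ _)) _ => //.
  by move=> k; apply: sub_sigma_algebra; exact: mF.
apply: lee_nneseries => // k _.
have lE : lambda (F k) = wlength idfun (F k).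
  exact: (lebesgue_stieltjes_ocitv idfun _ (mF k)).
by have /eqP := lE; rewrite eq_le => /andP[? _].
Qed.



(** The density is the Radon-Nikodym derivative of the Stieltjes measure of [g], and the
    differentiation theorem makes it the derivative of [g] almost everywhere. The derivative is
    stated along the increments [1/n], the form in which [chi] is defined. *)
Lemma absolutely_continuous_density g a b :
  {homo g : x y / x <= y} -> absolutely_continuous g -> a < b ->
  exists f : R -> R, [/\ lambda.-integrable setT (EFin \o f),
    forall t, a <= t -> t <= b ->
      (\int[lambda]_(x in `]a, t]) (f x)%:E = (g t - g a)%:E)%E &
    {ae lambda, forall x, a < x -> x < b ->
      n%:R * (g (x + n%:R^-1) - g x) @[n --> \oo] --> f x}].
Proof.
move=> ndg acg ab.
pose gc : cumulative R R := HB.pack g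
  (isCumulative.Build R _ R g ndg (right_continuousW (absolutely_continuous_continuous g acg))).
pose nu0 := lebesgue_stieltjes_measure gc.
have mI : measurable (`]a, b]%classic : set (measurableTypeR R)) by exact: measurable_itv.
have nuI : (nu0 `]a, b]%classic < +oo)%E.
  by rewrite /nu0 lebesgue_stieltjes_itv ?ltry// ltW.
(* Restricting to []a, b]] makes the measure finite, hence a charge. *)
pose nu := charge_of_finite_measure (mfrestr mI nuI).
have nulambda : nu `<< lambda.
  apply/null_content_dominatesP => A mA A0.
  have /null_content_dominatesP/(_ _ mA A0) nuA := lebesgue_stieltjes_ac gc acg.
  apply/eqP; rewrite eq_le measure_ge0 andbT -[leRHS]nuA.
  by apply: le_measure; [apply/mem_set; exact: measurableI|exact: mem_set|exact: subIsetl].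
pose f := Radon_Nikodym nu lambda.
have intf : lambda.-integrable setT f := Radon_Nikodym_integrable nulambda.
exists (fine \o f).
have fE : EFin \o (fine \o f) = f.
  by apply/funext => x /=; rewrite fineK// Radon_Nikodym_fin_num.
have intF t : a <= t -> t <= b ->
    (\int[lambda]_(x in `]a, t]) ((fine \o f) x)%:E = (g t - g a)%:E)%E.
  move=> at_ tb.
  rewrite (_ : (fun x => _) = f); last exact: fE.
  rewrite -Radon_Nikodym_integral//.
  rewrite -(lebesgue_stieltjes_itv gc)//= /mfrestr/= /mrestr setIidl//.
  by apply: subset_itvl; rewrite bnd_simp.
split => //; first by rewrite fE.
have locf : locally_integrable setT (fine \o f).
  by apply: open_integrable_locally; [exact: openT|rewrite fE].
have intfy y : lambda.-integrable [set` Interval (BRight a) (BRight y)] (EFin \o (fine \o f)).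
  by rewrite fE; apply: integrableS intf.
have := FTC1 intfy locf.
apply: filterS; first exact: (ae_filter_ringOfSetsType lambda).
move=> x xP ax xb.
have [dF <-] := xP ax.
rewrite derive1E; have := cvg_comp _ _ (@cvgn_invn_dnbhs R) dF.
(* For large [n] the point [x + 1/n] is still at most [b], where the primitive of the density is
   [g - g a]. *)
apply: cvg_trans; apply: near_eq_cvg; near=> n => /=.
have n0 : (0 < n)%N by near: n; exact: nbhs_infty_gt.
have xnb : x + n%:R^-1 <= b.
  rewrite -lerBrDl; near: n.
  apply: (cvgr_le (0 : R)); first exact: cvgn_invn.
  by rewrite subr_gt0.
have an : a <= x + n%:R^-1 by rewrite ler_wpDr ?invr_ge0// ltW.
have FE t : a <= t -> t <= b ->
    (\int[lambda]_(y in `]a, t]) (fine \o f) y)%R = g t - g a.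
  by move=> at_ tb; rewrite /Rintegral intF.
rewrite invrK [_%:A]mulr1 (addrC _ x) !FE// ?ltW//.
by rewrite /GRing.scale/=; ring.
Unshelve. all: by end_near. Qed.

End absolute_continuity.

(** Names the bundled measure structure of a pushforward, which depends on the proof [mf]. *)
Definition pushforward_measure d1 d2 (T1 : measurableType d1) (T2 : measurableType d2)
    (R : realType) (m : {measure set T1 -> \bar R}) (f : T1 -> T2)
    (mf : measurable_fun setT f) : {measure set T2 -> \bar R} :=
  measure_function_pushforward__canonical__measure_function_Measure m mf.

Arguments pushforward_measure {d1 d2 T1 T2 R} m {f} mf.

(** * Measurability of continuous maps, and translation of Lebesgue measure *)

Section topology_measurability.
Context {R : realType}.
Local Notation lambda := (@lebesgue_measure R).

Lemma continuous_measurable_borel (S T : ptopologicalType) (f : S -> T) :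
  continuous f -> measurable_fun setT (f : borel S -> borel T).
Proof.
move=> /continuousP cf; apply: (@measurability _ _ _ (borel T) setT _ (@open T)) => //.
move=> _ [U oU <-]; rewrite setTI; apply: sub_sigma_algebra; exact: cf.
Qed.

(* An open subset of S x R is a countable union of rectangles with rational
   sides in R, whether or not S is second countable. *)
Lemma continuous_measurable_prodR (S T : ptopologicalType) (f : S * R -> T) :
  continuous f -> measurable_fun setT (f : borel S * R -> borel T).
Proof.
move=> /continuousP cf; apply: (@measurability _ _ _ (borel T) setT _ (@open T)) => //.
move=> _ [U /cf oU <-]; rewrite setTI.
(* [A q] is the largest open set whose product with the rational interval [q] lies in the preimage;
   countability comes from the rational endpoints alone. *)
pose A (q : rat * rat) := \bigcup_(B in [set B : set S | open B /\
  B `*` `]ratr q.1, ratr q.2[%classic `<=` f @^-1` U]) B.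
have oA q : open (A q) by apply: bigcup_open => B [].
rewrite (_ : f @^-1` U = \bigcup_q (A q `*` `]ratr q.1, ratr q.2[%classic)).
  apply: countable_bigcupT_measurable => // q; apply: measurableX.
    exact: sub_sigma_algebra.
  exact: measurable_itv.
apply/seteqP; split => [[x t] Uxt|[x t] [q _ [[B [_ BU] Bx] qt]]]; last exact: BU.
have : nbhs (x, t) (f @^-1` U) by exact: open_nbhs_nbhs.
move=> [[B1 B2] /= [+ B2t] BU]; rewrite nbhsE => -[B [oB Bx] BB1].
have [e /= e0 eB2] : exists2 e : R, 0 < e & forall s, `|t - s| < e -> B2 s.
  by move: B2t => /nbhs_ballP[e e0 eB2]; exists e.
have [q1] := @rat_in_itvoo R (t - e) t ltac:(by rewrite ltrBlDr ltrDl).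
have [q2] := @rat_in_itvoo R t (t + e) ltac:(by rewrite ltrDl).
rewrite !in_itv/= => /andP[tq2 q2e] /andP[eq1 q1t].
exists (q1, q2) => //; split => /=; last by rewrite in_itv/= q1t tq2.
exists B => //; split => // -[y s] [/= By]; rewrite in_itv/= => /andP[q1s sq2].
apply: BU; split => /=; first exact: BB1.
apply: eB2; rewrite ltr_distlC; apply/andP; split.
  exact: lt_trans q1s.
exact: lt_trans q2e.
Qed.

(** The image of Lebesgue measure under a translation gives half-open intervals their length, and
    Lebesgue measure is unique with this property. *)
Lemma pushforward_lebesgue_measureD (s : R) (A : set (measurableTypeR R)) :
  measurable A -> lambda (+%R s @^-1` A) = lambda A.
Proof.
have ms : measurable_fun setT (+%R s : measurableTypeR R -> measurableTypeR R).
  by apply: measurable_funD.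
pose m := pushforward_measure lambda ms.
move=> mA; apply/esym; apply: (@lebesgue_measure_unique R m) => // X [[a b] _ <-].
rewrite /m/= /pushforward.
rewrite (_ : _ @^-1` _ = `]a - s, b - s]%classic); last first.
  by apply/seteqP; split => x /=; rewrite !in_itv/= ltrBlDl lerBrDl.
rewrite !lebesgue_measure_itv/= !lte_fin ltrD2r.
by case: ifPn => // _; rewrite -!EFinD/=; congr EFin; ring.
Qed.

(** By translation invariance the left side is the integral of [f] over the smaller set [[s,
    +oo[]. *)
Lemma ge0_integral_translation_le (s : R) (f : R -> \bar R) :
  0 <= s -> measurable_fun setT f -> (forall x, 0 <= f x)%E ->
  (\int[lambda]_(x in `[0%R, +oo[) f (s + x)%R <=
   \int[lambda]_(x in `[0%R, +oo[) f x)%E.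
Proof.
move=> s0 mf f0.
have ms : measurable_fun setT (+%R s : measurableTypeR R -> measurableTypeR R).
  by apply: measurable_funD.
have preE : `[0%R, +oo[%classic = +%R s @^-1` `[s, +oo[%classic.
  by apply/seteqP; split => x /=; rewrite !in_itv/= !andbT lerDl.
rewrite {1}preE.
rewrite -(@ge0_integral_pushforward _ _ _ _ _ _ ms lambda `[s, +oo[%classic f)//; last first.
  exact: measurable_funTS.
rewrite (@eq_measure_integral _ _ _ _ lambda); last first.
  by move=> A mA _; exact: pushforward_lebesgue_measureD.
apply: ge0_subset_integral => //; last by apply: subset_itvr; rewrite bnd_simp.
exact: measurable_funTS.
Qed.

End topology_measurability.

(** * Regularity of the flow and of the set [V] *)

Section controlled_flow.
Context {R : realType} {M : model R}.
Hypothesis Hcompact : compactness_continuity M.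
Local Notation lambda := (@lebesgue_measure R).

Lemma phi_max (x : X M) (u : R) : phi x (Num.max u 0) = phi x u.
Proof. by apply: val_inj => /=; rewrite -maxA maxxx. Qed.

Lemma phi0 (x : X M) : phi x 0 = x.
Proof.
by apply: val_inj => /=; rewrite maxxx flow0 addr0; case: (val x).
Qed.

Lemma phiD (x : X M) (s u : R) : 0 <= s -> 0 <= u -> phi (phi x s) u = phi x (s + u).
Proof.
move=> s0 u0; apply: val_inj => /=; rewrite !max_l ?addr_ge0//.
by rewrite -flowD// addrA [u + s]addrC.
Qed.

Lemma continuous_start : continuous (start (base_flow M)).
Proof.
apply: (@continuous_comp_initial _ _ _ (@set_val _ (state_set (base_flow M)))).
move=> x; have h1 : (id : base M -> base M) @ x --> x by exact: cvg_id.
have h2 : (cst 0 : base M -> R) @ x --> (0 : R) by exact: cvg_cst.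
exact: (cvg_pair h1 h2).
Qed.

(** As negative durations are truncated, [phi] factors through the retraction of time onto [[0,
    +oo[], where its continuity is assumed. *)
Lemma continuous_phi : continuous (fun p : X M * R => phi p.1 p.2).
Proof.
have [_ _ cphi _ _] := Hcompact.
pose pos (p : X M * R) := (p.1, Num.max p.2 0).
rewrite (_ : (fun p => _) = (fun p => phi p.1 p.2) \o pos); last first.
  by apply/funext => p /=; rewrite phi_max.
have cpos : continuous pos.
  move=> p; have h1 : (fst : X M * R -> X M) x @[x --> p] --> p.1 by exact: cvg_fst.
  have h2 : ((snd : X M * R -> R^o) \max cst 0) @ p --> Num.max p.2 0.
    by apply: continuous_max; [exact: cvg_snd|exact: cvg_cst].
  exact: (cvg_pair h1 h2).
move=> p U /(cphi (pos p)); rewrite nbhs_simpl /nbhs/= -nbhs_subspace_in; last first.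
  by rewrite /= le_max lexx orbT.
move=> /(cpos p) H; suff : \forall q \near p, U (phi (pos q).1 (pos q).2) by [].
apply: (@filterS _ (nbhs p) (nbhs_filter p) _ _ _ H) => q /=; apply.
by rewrite /= le_max lexx orbT.
Qed.

Lemma measurable_start :
  measurable_fun setT (start (base_flow M) : borel (base M) -> borel (X M)).
Proof. by apply: continuous_measurable_borel; exact: continuous_start. Qed.

Lemma measurable_phi :
  measurable_fun setT ((fun p => phi p.1 p.2) : borel (X M) * R -> borel (X M)).
Proof. by apply: continuous_measurable_prodR; exact: continuous_phi. Qed.

Lemma measurable_jump : measurable_fun setT
  ((fun p => jump p.1 p.2) : borel (X M) * borel (action M) -> borel (X M)).
Proof. exact: measurableT_comp measurable_start (@base_jump_measurable _ M). Qed.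

Lemma measurable_cost : measurable_fun setT
  ((fun p => (\sum_j Cg j (phi p.1 p.2))%:E) : borel (X M) * R -> \bar R).
Proof.
apply/measurable_EFinP; apply: measurable_sum => j.
exact: measurableT_comp (@Cg_measurable _ M j) measurable_phi.
Qed.

Lemma cost_ge0 (x : X M) : (0 <= (\sum_j Cg j x)%:E)%E.
Proof. by rewrite lee_fin sumr_ge0// => j _; exact: Cg_ge0. Qed.

(** By Tonelli, the total running cost is a measurable function of the starting state; [F] carries
    the time domain as an indicator. *)
Lemma measurable_V : measurable (V M : set (borel (X M))).
Proof.
pose F (p : borel (X M) * R) : \bar R :=
  ((\1_`[0%R, +oo[%classic p.2)%:E * (\sum_j Cg j (phi p.1 p.2))%R%:E)%E.
have mF : measurable_fun setT F.
  apply: emeasurable_funM; last exact: measurable_cost.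
  by apply/measurable_EFinP; apply: measurableT_comp => //; exact: measurable_indic.
have F0 p : (0 <= F p)%E by rewrite mule_ge0 ?lee_fin ?sumr_ge0// => j _; exact: Cg_ge0.
rewrite (_ : V M = setT `&` [set x | (0 < \int[lambda]_u F (x, u))%E]).
  apply: emeasurable_fun_o_infty => //.
  exact: measurable_fun_fubini_tonelli_F.
rewrite setTI; apply/funext => x; rewrite /V/= integral_mkcond epatch_indic.
congr (is_true (0 < _)%E).
by apply: eq_integral => u _; rewrite /F/= muleC.
Qed.

(** The running cost from [phi y s] is a tail of that from [y], so it vanishes with it. *)
Lemma phi_notin_V (y : X M) (s : R) : 0 <= s -> ~ V M y -> ~ V M (phi y s).
Proof.
move=> s0 nVy; apply: contra_not nVy; rewrite /V/=; move=> /lt_le_trans; apply.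
under eq_integral => u.
  rewrite inE/= in_itv/= andbT => u0; rewrite phiD//; over.
apply: (ge0_integral_translation_le s (fun u => (\sum_j Cg j (phi y u))%:E)) => //.
- exact: measurable_fun_pair2 measurable_cost.
- by move=> u; exact: cost_ge0.
Qed.

End controlled_flow.

(** * Measurability of limits with a default value *)

Section sequence_limits.
Context {R : realType}.

Lemma limn_esup_einf_cvg (u : (\bar R)^nat) :
  limn_esup u = limn_einf u -> u @ \oo --> limn_esup u.
Proof.
rewrite limn_esup_lim limn_einf_lim => eq_lim.
apply: (@squeeze_cvge _ _ _ _ (einfs u) _ (esups u)).
- apply: nearW => n; apply/andP; split.
    by apply: ereal_inf_lbound; exists n => /=.
  by apply: ereal_sup_ubound; exists n => /=.
- by rewrite eq_lim; exact: is_cvg_einfs.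
- exact: is_cvg_esups.
Qed.

(** A real sequence converges exactly when its upper and lower limits agree and are finite. This
    replaces the convergence test by conditions on measurable functions. *)
Lemma limn_defaultE (u : R^nat) (a := limn_esup (EFin \o u)) :
  (if `[< cvgn u >] then limn u else 0) =
  if (a == limn_einf (EFin \o u)) && (a \is a fin_num) then fine a else 0.
Proof.
case: asboolP => [cu|ncu].
  have cE : EFin \o u @ \oo --> (limn u)%:E by apply: cvg_EFin; [exact: nearW|exact: cu].
  by rewrite /a !(cvg_limn_einf_sup cE) eqxx.
case: ifPn => // /andP[/eqP /limn_esup_einf_cvg cE afin]; exfalso; apply: ncu.
by apply/cvg_ex; exists (fine a); move: cE; rewrite -/a -{1}(fineK afin) => /fine_cvgP[].
Qed.

Lemma measurable_limn_default d (T : measurableType d) (h : (T -> R)^nat) :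
  (forall n, measurable_fun setT (h n)) ->
  measurable_fun setT (fun x => if `[< cvgn (h ^~ x) >] then limn (h ^~ x) else 0).
Proof.
move=> mh.
have mE n : measurable_fun setT (EFin \o h n) by apply/measurable_EFinP; exact: mh.
have msup : measurable_fun setT (fun x => limn_esup (EFin \o h ^~ x)).
  exact: (measurable_fun_limn_esup mE).
have minf : measurable_fun setT (fun x => limn_einf (EFin \o h ^~ x)).
  rewrite /limn_einf; apply: measurableT_comp => //.
  apply: (@measurable_fun_limn_esup _ _ _ _ (fun n x => - (h n x)%:E)%E) => n.
  by apply: measurableT_comp => //; exact: mE.
under eq_fun do rewrite limn_defaultE.
apply: measurable_fun_ifT => //; last exact: measurableT_comp.
apply: measurable_and; first exact: measurable_fun_eqe.
apply: (measurable_fun_bool true); rewrite setTI.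
have := emeasurable_fin_num measurableT msup.
by rewrite setTI.
Qed.

End sequence_limits.

(** * Test functions and [chi] along orbits *)

Section test_functions.
Context {R : realType} {M : model R}.
Hypothesis Hcompact : compactness_continuity M.
Local Notation lambda := (@lebesgue_measure R).

Lemma test_functionN (w : X M -> R) : test_function w -> test_function (fun x => - w x).
Proof.
move=> [[K wK] mw acw monow w_out w_lim]; split.
- by exists K => x; rewrite normrN.
- exact: measurableT_comp mw.
- move=> x T T0 e /(acw x T T0)[d d0 dP]; exists d => // n s t st dis std.
  by under eq_bigr do rewrite -opprD normrN; exact: dP.
- case: monow => [[w0 wle]|[w0 wle]]; [right|left]; split => [x|x s t s0 st].
  + by rewrite oppr_ge0.
  + by rewrite lerN2; exact: wle.
  + by rewrite oppr_le0.
  + by rewrite lerN2; exact: wle.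
- by move=> y /w_out ->; rewrite oppr0.
- by move=> x Vx /(w_lim x Vx) wx; rewrite -oppr0; exact: cvgN.
Qed.

(** The two sequences of difference quotients converge together; where they do not, both sides are
    the default 0. *)
Lemma chiN (w : X M -> R) (x : X M) : chi (fun y => - w y) x = - chi w x.
Proof.
rewrite /chi; set q := fun n : nat => _; set q' := fun n : nat => _.
have -> : q = - q'.
  by apply/funext => n; rewrite /q /q' /= fctE /=; ring.
case: asboolP => cNq; case: asboolP => cq; rewrite ?oppr0//.
- by rewrite limN.
- by exfalso; apply: cq; rewrite -is_cvgNE.
- by exfalso; apply: cNq; rewrite is_cvgNE.
Qed.

Lemma measurable_phit (t : R) : measurable_fun setT
  ((fun x => phi x t) : borel (X M) -> borel (X M)).
Proof. exact: measurable_fun_pair1 (measurable_phi Hcompact). Qed.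

Variable w : X M -> R.
Hypothesis Hw : test_function w.

Lemma test_phi_out (y : X M) (s : R) : 0 <= s -> ~ V M y -> w (phi y s) = 0.
Proof. by move=> s0 nVy; apply: (test_out Hw); apply: phi_notin_V. Qed.

Lemma chi_out (y : X M) : ~ V M y -> chi w y = 0.
Proof.
move=> nVy; rewrite /chi (_ : (fun n => _) = cst 0).
  by case: asboolP => // _; exact: lim_cst.
apply/funext => n /=.
by rewrite test_phi_out ?invr_ge0// (test_out Hw) // subr0 mulr0.
Qed.

Lemma measurable_chi : measurable_fun setT (chi w : borel (X M) -> R).
Proof.
apply: (measurable_limn_default _ _
  (fun (n : nat) (x : borel (X M)) => n%:R * (w (phi x n%:R^-1) - w x))) => n.
apply: measurable_funM => //; apply: measurable_funB.
  exact: measurableT_comp (test_measurable Hw) (measurable_phit _).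
exact: (test_measurable Hw).
Qed.

Hypothesis w_incr : forall x s t, 0 <= s -> s <= t -> w (phi x s) <= w (phi x t).

Lemma chi_ge0 x : 0 <= chi w x.
Proof.
rewrite /chi; case: asboolP => // cq; apply: limr_ge => //.
apply: nearW => n; rewrite mulr_ge0// subr_ge0 -[leLHS](congr1 w (phi0 x)).
by apply: w_incr; rewrite ?invr_ge0.
Qed.

Lemma measurable_chi_orbit (x : X M) :
  measurable_fun setT ((fun s => (chi w (phi x s))%:E) : R -> \bar R).
Proof.
apply/measurable_EFinP; apply: (measurableT_comp measurable_chi).
exact: measurable_fun_pair2 (measurable_phi Hcompact).
Qed.

(** The density of the orbit function, frozen outside [[0, T]], integrates to its increments. It
    equals [chi w] almost everywhere on the orbit, as moving from [phi x s] during [1/n] leads to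
    [phi x (s + 1/n)]. *)
Lemma chi_integral (x : X M) (T : R) : 0 <= T ->
  (\int[lambda]_(s in `[0%R, T]) (chi w (phi x s))%:E = (w (phi x T) - w x)%:E)%E.
Proof.
rewrite le_eqVlt => /predU1P[<-|T0].
  by rewrite set_itv1 integral_set1 phi0 subrr.
pose g := (fun t => w (phi x t)) \o clamp 0 T.
have gE t : 0 <= t -> t <= T -> g t = w (phi x t).
  by move=> t0 tT; rewrite /g /= clamp_id.
have ndg : {homo g : s t / s <= t}.
  move=> s t st; apply: w_incr; first exact: (clamp_itv 0 T s (ltW T0)).1.
  exact: clamp_homo.
have acg : absolutely_continuous g.
  apply: (absolutely_continuous_clamp 0 T (fun t => w (phi x t)) (ltW T0)).
  by apply: (test_ac Hw); exact: ltW.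
have [f [intf fI fae]] := absolutely_continuous_density g 0 T ndg acg T0.
have mf : measurable_fun setT (EFin \o f) by exact: measurable_int intf.
(* Endpoints are dropped because the density is identified only inside the interval. *)
rewrite integral_itv_bndoo; last exact: measurable_funTS (measurable_chi_orbit x).
transitivity (\int[lambda]_(s in `]0%R, T]) (f s)%:E)%E; last first.
  by rewrite fI ?lexx ?(ltW T0)// !gE ?lexx ?ltW// phi0.
rewrite [RHS]integral_itv_bndoo; last exact: (measurable_funTS mf).
apply: ae_eq_integral => //.
- exact: measurable_funTS (measurable_chi_orbit x).
- exact: (measurable_funTS mf).
move: fae; apply: filterS; first exact: (ae_filter_ringOfSetsType lambda).
move=> s fs /=; rewrite in_itv/= => /andP[s0 sT]; congr EFin.
have {}fs := fs s0 sT.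
suff qs : n%:R * (w (phi (phi x s) n%:R^-1) - w (phi x s)) @[n --> \oo] --> f s.
  by rewrite /chi asboolT; [exact: cvg_lim qs|apply/cvg_ex; exists (f s)].
apply: cvg_trans fs; apply: near_eq_cvg; near=> n.
have snT : s + n%:R^-1 <= T.
  rewrite -lerBrDl; near: n; apply: (cvgr_le (0 : R)); first exact: cvgn_invn.
  by rewrite subr_gt0.
by rewrite phiD ?invr_ge0 ?(ltW s0)// !gE ?addr_ge0 ?invr_ge0 ?(ltW s0) ?(ltW sT).
Unshelve. all: by end_near. Qed.

Lemma chi_integraly (x : X M) : V M x ->
  (\int[lambda]_(s in `[0%R, +oo[) (chi w (phi x s))%:E = (- w x)%:E)%E.
Proof.
move=> Vx.
have w_lim0 : w (phi x t) @[t --> +oo] --> (0 : R).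
  (* Either the orbit stays in [V] and the limit is part of the definition of a test function, or it
     leaves [V] and [w] is 0 from then on. *)
  have [VxV|] := pselect (forall t, 0 <= t -> V M (phi x t)).
    exact: (test_lim Hw Vx VxV).
  move=> /existsNP[t /not_implyP[t0 nVt]].
  apply: cvg_near_cst; near=> s.
  have ts : t <= s by near: s; apply: nbhs_pinfty_ge; exact: num_real.
  by rewrite -(subrK t s) addrC -phiD ?subr_ge0// test_phi_out// subr_ge0.
(* Monotone convergence, as [chi w] is nonnegative. *)
have cI : (\int[lambda]_(s in `[0%R, n%:R%R]) (chi w (phi x s))%:E)%E @[n --> \oo] -->
    (\int[lambda]_(s in `[0%R, +oo[) (chi w (phi x s))%:E)%E.
  apply: ge0_cvgn_integral => [s|]; first exact: chi_ge0.
  by apply/measurable_EFinP; exact: measurable_chi_orbit.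
apply: (cvg_unique _ cI) => //.
rewrite (_ : (fun n : nat => _) = (fun n : nat => (w (phi x n%:R) - w x)%:E)); last first.
  by apply/funext => n; rewrite chi_integral.
apply: cvg_EFin; first exact: nearW.
have wn : w (phi x n%:R) @[n --> \oo] --> (0 : R).
  exact: (cvg_comp _ _ (@cvgr_idn R) w_lim0).
have wx : (fun _ : nat => w x) @ \oo --> w x by exact: cvg_cst.
have := cvgB wn wx; rewrite sub0r => wnx; exact: (wnx eventually_filter).
Unshelve. all: by end_near. Qed.

End test_functions.

(** * Image measures and uniqueness on products *)

Section image_measure.
Context {R : realType} {d1 d2} {T1 : measurableType d1} {T2 : measurableType d2}.
Variables (m : {measure set T1 -> \bar R}) (D : set T1) (mD : measurable D).
Variables (f : T1 -> T2) (mf : measurable_fun setT f).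
Local Open Scope ereal_scope.

(** Turns the integral of [F \o f] over [D] into the integral of [F] against a measure, so that
    equalities of integrals reduce to equalities on sets. *)
Definition image_measure : {measure set T2 -> \bar R} :=
  pushforward_measure (mrestr m mD) mf.

Lemma image_measureE (A : set T2) : image_measure A = m (D `&` f @^-1` A).
Proof. by rewrite setIC. Qed.

Lemma ge0_integral_mrestr (F : T1 -> \bar R) :
  measurable_fun setT F -> (forall x, 0 <= F x) ->
  \int[mrestr m mD]_x F x = \int[m]_(x in D) F x.
Proof.
move=> mF F0; rewrite -(setUv D) ge0_integral_setU//=;
  [|exact: measurableC|by rewrite setUv|exact/disj_setPCl].
rewrite (@eq_measure_integral _ _ _ (~` D) mzero) ?integral_measure_zero ?adde0; last first.
  move=> A mA ADC; have AD0 : A `&` D = set0 by apply/seteqP; split => // x [/ADC].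
  by rewrite /= /mrestr AD0 measure0.
apply: eq_measure_integral => A mA AD.
by rewrite /= /mrestr setIidl.
Qed.

Lemma ge0_integral_image_measure (F : T2 -> \bar R) :
  measurable_fun setT F -> (forall y, 0 <= F y) ->
  \int[image_measure]_y F y = \int[m]_(x in D) F (f x).
Proof.
move=> mF F0.
rewrite (ge0_integral_pushforward mf)// preimage_setT ge0_integral_mrestr//.
  exact: measurableT_comp.
by move=> x /=.
Qed.

End image_measure.

Lemma integral_indic_comp {R : realType} {d1 d2} {T1 : measurableType d1} {T2 : measurableType d2}
    (m : {measure set T1 -> \bar R}) (D : set T1) (A : set T2) (f : T1 -> T2) :
  measurable D -> measurable A -> measurable_fun setT f ->
  (\int[m]_(x in D) (\1_A (f x))%:E = m (D `&` f @^-1` A))%E.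
Proof.
move=> mD mA mf; rewrite setIC.
have mfA : measurable (f @^-1` A) by rewrite -[Z in measurable Z]setTI; exact: mf.
by rewrite -integral_indic.
Qed.

Lemma integral_support {R : realType} {d} {T : measurableType d}
    (m : {measure set T -> \bar R}) (D : set T) (F : T -> \bar R) :
  (forall x, ~ D x -> F x = 0%E) -> (\int[m]_(x in D) F x = \int[m]_x F x)%E.
Proof.
move=> F0; rewrite integral_mkcond; apply: eq_integral => x _; rewrite patchE.
by case: ifPn => // /negP; rewrite in_setE => /F0.
Qed.

(** Rectangles are stable under intersection and generate the product sigma-algebra; the whole space
    is a rectangle of finite measure. *)
Lemma measure_prod_unique {R : realType} {d1 d2} {T1 : measurableType d1} {T2 : measurableType d2}
    (m1 m2 : {measure set (T1 * T2)%type -> \bar R}) :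
  (m1 setT < +oo)%E ->
  (forall A B, measurable A -> measurable B -> m1 (A `*` B) = m2 (A `*` B)) ->
  forall C, measurable C -> m1 C = m2 C.
Proof.
move=> m1oo m12 C mC.
apply: (measure_unique [set A `*` B | A in measurable & B in measurable] (fun=> setT)) => //.
- exact: measurable_prod_measurableType.
- move=> _ _ [A mA [B mB <-]] [A' mA' [B' mB' <-]]; rewrite -setXI.
  by exists (A `&` A'); [exact: measurableI|exists (B `&` B'); [exact: measurableI|]].
- by move=> _; exists setT => //; exists setT => //; rewrite setXTT.
- by apply/seteqP; split => // x _; exists 0%N.
- by move=> _ [A mA [B mB <-]]; exact: m12.
Qed.

(** * From the defining formulas of [mu] and [eta] to integrals *)

Section occupation.
Context {R : realType} {M : model R}.
Hypothesis Hcompact : compactness_continuity M.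
Local Notation lambda := (@lebesgue_measure R).
Local Notation impulse_space := (borel (X M) * \bar R * borel (action M))%type.
Local Notation aggregated_space := (borel (X M) * borel (adjoin (action M)))%type.
Variable mu : {finite_measure set impulse_space -> \bar R}.
Local Open Scope ereal_scope.

Let started : set impulse_space :=
  V M `*` [set theta | (0 <= theta)%E] `*` setT.
Let impulsive : set impulse_space :=
  V M `*` [set theta | (0 <= theta < +oo)%E] `*` setT.

(** The state just before the impulse. At an infinite time [fine] returns 0, so this is meaningful
    only on [impulsive]. *)
Definition post_flow (z : impulse_space) : borel (X M) := phi z.1.1 (fine z.1.2).

Definition post_jump (z : impulse_space) : borel (X M) :=
  jump (phi z.1.1 (fine z.1.2)) z.2.

Lemma measurable_post_flow : measurable_fun setT post_flow.
Proof.
have mp : measurable_fun setT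
    ((fun z => (z.1.1, fine z.1.2)) : impulse_space -> borel (X M) * R).
  apply: measurable_fun_pair; first exact: measurableT_comp.
  by apply: measurableT_comp => //; exact: measurableT_comp.
exact: measurableT_comp (measurable_phi Hcompact) mp.
Qed.

Lemma measurable_post_jump : measurable_fun setT post_jump.
Proof.
have mp : measurable_fun setT
    ((fun z => (post_flow z, z.2)) : impulse_space -> borel (X M) * borel (action M)).
  by apply: measurable_fun_pair => //; exact: measurable_post_flow.
exact: measurableT_comp measurable_jump mp.
Qed.

Lemma measurable_time_ge0 (t : \bar R) : measurable [set theta : \bar R | (t <= theta)%E].
Proof.
rewrite (_ : [set _ | _] = [set` Interval (BLeft t) +oo%O]); first exact: emeasurable_itv.
by apply/seteqP; split => x /=; rewrite in_itv/= andbT.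
Qed.

Lemma measurable_time_fin : measurable [set theta : \bar R | (0 <= theta < +oo)%E].
Proof.
rewrite (_ : [set _ | _] = [set` Interval (BLeft 0) (BLeft +oo)]); first exact: emeasurable_itv.
by apply/seteqP; split => x /=; rewrite in_itv.
Qed.

Lemma measurable_started : measurable started.
Proof.
apply: measurableX => //; apply: measurableX; first exact: measurable_V.
exact: measurable_time_ge0.
Qed.

Lemma measurable_impulsive : measurable impulsive.
Proof.
apply: measurableX => //; apply: measurableX; first exact: measurable_V.
exact: measurable_time_fin.
Qed.

(** The occupation equation equates two measures on the measurable subsets of [V], and [F] vanishes
    off [V]. *)
Lemma occupation_equation_integral (F : borel (X M) -> \bar R) :
  occupation_equation mu ->
  measurable_fun setT F -> (forall x, 0 <= F x) -> (forall x, ~ V M x -> F x = 0) ->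
  \int[mu]_(z in started) F z.1.1 =
  F (x0 M) + \int[mu]_(z in impulsive) F (post_jump z).
Proof.
move=> mueq mF F0 FV.
have mx : measurable_fun setT (fun z : impulse_space => z.1.1) by exact: measurableT_comp.
rewrite -(ge0_integral_image_measure mu _ measurable_started _ mx)//.
rewrite -(ge0_integral_image_measure mu _ measurable_impulsive _ measurable_post_jump)//.
have -> : F (x0 M) = \int[\d_(x0 M : borel (X M))]_x F x.
  by rewrite integral_dirac// diracT mul1e.
rewrite -!(integral_support _ (V M : set (borel (X M))) F FV).
rewrite -ge0_integral_measure_add//; last 2 first.
- exact: measurable_V.
- exact: measurable_funTS.
apply: eq_measure_integral => A mA AV.
rewrite [RHS]measure_addE !image_measureE.
rewrite -(integral_indic_comp mu impulsive A post_jump)//;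
  [|exact: measurable_impulsive|exact: measurable_post_jump].
rewrite -mueq//; congr (mu _).
by apply/seteqP; split => [z [[[_ ?] _] ?]|z [[/[dup] /AV]]].
Qed.

Variable eta : {measure set aggregated_space -> \bar R}.
Hypothesis eta_mu : aggregated_occupation_measure mu eta.

Lemma measurable_None : measurable ([set None] : set (borel (adjoin (action M)))).
Proof.
apply: sub_sigma_algebra; change (open (Some @^-1` [set None] : set (action M))).
rewrite (_ : _ @^-1` _ = set0); first exact: open0.
by apply/seteqP; split => [a|].
Qed.

(** Openness in [adjoin] is judged on the trace, and the trace of the preimage of an open set is
    that set itself. *)
Lemma measurable_odflt : measurable_fun setT
  (odflt point : borel (adjoin (action M)) -> borel (action M)).
Proof.
by apply: continuous_measurable_borel; apply/continuousP => U oU; exact: oU.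
Qed.

Lemma measurable_box_part (G : set (borel (X M))) : measurable G ->
  measurable (box_part G : set aggregated_space).
Proof.
move=> mG; rewrite (_ : box_part G = G `*` [set None]); last first.
  by apply/seteqP; split => -[].
by apply: measurableX => //; exact: measurable_None.
Qed.

Lemma measurable_action_part (G : set (borel (X M))) : measurable G ->
  measurable (action_part G setT : set aggregated_space).
Proof.
move=> mG; rewrite (_ : action_part G setT = G `*` ~` [set None]); last first.
  apply/seteqP; split => -[x [a|]]/=; first by move=> [].
  - by move=> [_ []].
  - by move=> [Gx _]; split => //; exists a.
  - by move=> [_ []].
by apply: measurableX => //; apply: measurableC; exact: measurable_None.
Qed.

(** On [V] the box part of [eta] is the image under [ph] of the product of Lebesgue measure and
    [mu], restricted to the region [E] below the impulse time. Tonelli then puts the time integral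
    inside. *)
Lemma aggregated_box_integral (F : borel (X M) -> \bar R) :
  measurable_fun setT F -> (forall x, 0 <= F x) -> (forall x, ~ V M x -> F x = 0) ->
  \int[eta]_(p in box_part (V M)) F p.1 =
  \int[mu]_(z in started) \int[lambda]_(u in [set u : R | (0 <= u)%R /\ u%:E <= z.1.2])
     F (phi z.1.1 u).
Proof.
move=> mF F0 FV; have [_ eta_box _] := eta_mu.
pose E : set (R * impulse_space) :=
  [set q | [/\ (0 <= q.1)%R, started q.2 & q.1%:E <= q.2.1.2]].
pose ph (q : R * impulse_space) : borel (X M) := phi q.2.1.1 q.1.
have mph : measurable_fun setT ph.
  have mp : measurable_fun setT
      ((fun q => (q.2.1.1, q.1)) : R * impulse_space -> borel (X M) * R).
    apply: measurable_fun_pair => //; apply: measurableT_comp => //.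
    exact: measurableT_comp.
  exact: measurableT_comp (measurable_phi Hcompact) mp.
have mE : measurable E.
  rewrite (_ : E = (`[0%R, +oo[%classic `*` started) `&` [set q | q.1%:E <= q.2.1.2]); last first.
    apply/seteqP; split => -[u z] /=; rewrite in_itv/= andbT; first by move=> [].
    by move=> [[]].
  apply: measurableI; first exact: (measurableX (measurable_itv _) measurable_started).
  rewrite -[Z in measurable Z]setTI; apply: measurable_lee => //.
    by apply/measurable_EFinP.
  by apply: measurableT_comp => //; exact: measurableT_comp.
have mfst : measurable_fun setT (fst : aggregated_space -> borel (X M)) by [].
have mbox : measurable (box_part (V M) : set aggregated_space).
  by apply: measurable_box_part; exact: measurable_V.
rewrite -(ge0_integral_image_measure eta _ mbox _ mfst)//.
transitivity (\int[lambda \x mu]_(q in E) F (ph q)).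
  rewrite -(ge0_integral_image_measure (lambda \x mu) _ mE _ mph)//.
  rewrite -!(integral_support _ (V M : set (borel (X M))) F FV).
  apply: eq_measure_integral => A mA AV.
  rewrite !image_measureE.
  rewrite (_ : _ `&` _ = box_part A); last first.
    by apply/seteqP; split => [p [[? ?] ?]|p [/[dup] /AV ? ? ?]].
  rewrite eta_box//.
  transitivity (\int[lambda]_u mu (xsection (E `&` ph @^-1` A) u)); last by [].
  rewrite integral_mkcond.
  apply: eq_integral => u _; rewrite patchE /=.
  (* For negative [u] the section of [E] is empty and the patched integrand is 0. *)
  have [u0|u0] := leP 0%R u; last first.
    rewrite memNset; last by rewrite /= in_itv/= andbT; apply/negP; rewrite -ltNge.
    rewrite (_ : xsection _ _ = set0) ?measure0//.
    apply/seteqP; split => // z; rewrite /xsection/= inE => -[[/= + _ _] _].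
    by rewrite leNgt u0.
  rewrite mem_set; last by rewrite /= in_itv/= andbT.
  have mphu : measurable_fun setT ((fun z => phi z.1.1 u) : impulse_space -> borel (X M)).
    apply: (measurableT_comp (measurable_phit Hcompact u)).
    exact: measurableT_comp.
  rewrite (integral_indic_comp _ _ A _ _ mA mphu); last first.
    apply: measurableX => //; apply: measurableX; first exact: measurable_V.
    exact: measurable_time_ge0.
  congr (mu _); apply/seteqP; split => z; rewrite /xsection/= inE.
    move=> [[[Vz uz] _] Aphi]; split => //; split => //=; split => //; split => //=.
    by rewrite (le_trans _ uz)// lee_fin.
  by move=> [[/= _ [[Vz _] _] uz] Aphi].
have mFph : measurable_fun setT (F \o ph) by exact: measurableT_comp.
rewrite integral_mkcond fubini_tonelli2; last 2 first.
- by apply/(measurable_restrictT _ mE); exact: measurable_funTS.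
- by move=> q; apply: erestrict_ge0 => q' _; exact: F0.
rewrite [RHS]integral_mkcond; apply: eq_integral => z _; rewrite patchE /fubini_G.
case: ifPn => [|/negP]; rewrite in_setE => sz.
  rewrite [RHS]integral_mkcond; apply: eq_integral => u _; rewrite !patchE.
  congr (if _ then _ else _); apply/idP/idP; rewrite !in_setE; first by move=> [].
  by move=> [u0 uz]; split.
rewrite -[RHS](integral0 lambda setT); apply: eq_integral => u _; rewrite patchE memNset//.
by move=> [].
Qed.

(** The formula for [eta] gives the equality of two measures on rectangles. As [F] may be nonzero
    off [V], the domain on the right requires the state before the impulse to be in [V]. *)
Lemma aggregated_action_integral (F : borel (X M) * borel (action M) -> \bar R) :
  measurable_fun setT F -> (forall x, 0 <= F x) ->
  \int[eta]_(p in action_part (V M) setT) F (p.1, odflt point p.2) =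
  \int[mu]_(z in impulsive `&` post_flow @^-1` V M) F (post_flow z, z.2).
Proof.
move=> mF F0; have [_ _ eta_action] := eta_mu.
have mD : measurable (action_part (V M) setT : set aggregated_space).
  by apply: measurable_action_part; exact: measurable_V.
have mDf : measurable (impulsive `&` post_flow @^-1` V M).
  apply: measurableI; first exact: measurable_impulsive.
  by rewrite -[Z in measurable Z]setTI; apply: measurable_post_flow => //; exact: measurable_V.
have m1 : measurable_fun setT ((fun p => (p.1, odflt point p.2)) :
    aggregated_space -> borel (X M) * borel (action M)).
  apply: measurable_fun_pair => //; apply: measurableT_comp => //.
  exact: measurable_odflt.
have m2 : measurable_fun setT ((fun z => (post_flow z, z.2)) :
    impulse_space -> borel (X M) * borel (action M)).
  by apply: measurable_fun_pair => //; exact: measurable_post_flow.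
rewrite -(ge0_integral_image_measure eta _ mD _ m1)//.
rewrite -(ge0_integral_image_measure mu _ mDf _ m2)//.
(* The sides are swapped so that the finite mass is asked of the image of [mu]. *)
apply: eq_measure_integral => C mC _; apply/esym; apply: measure_prod_unique => //.
  by rewrite image_measureE preimage_setT setIT ltey_eq fin_num_measure.
move=> A B mA mB; rewrite !image_measureE.
have mAV : measurable (A `&` V M : set (borel (X M))).
  by apply: measurableI => //; exact: measurable_V.
have mDB : measurable (V M `*` [set theta | 0 <= theta < +oo] `*` B : set impulse_space).
  apply: measurableX => //; apply: measurableX; first exact: measurable_V.
  exact: measurable_time_fin.
transitivity (eta (action_part (A `&` V M) B)); last first.
  congr (eta _); apply/seteqP; split => -[x [a|]]/=.
  - by move=> [[Ax Vx] [b Bb [->]]]; split; [split => //; exists b|].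
  - by move=> [_ []].
  - by move=> [[Vx _] [Ax Ba]]; split => //; exists a.
  - by move=> [[_ []]].
rewrite eta_action//.
rewrite (integral_indic_comp mu _ (A `&` V M : set (borel (X M))) post_flow
  mDB mAV measurable_post_flow).
congr (mu _); apply/seteqP; split => z /=.
  by move=> [[[[Vz ?] _] Vphi] [Aphi Bz]].
by move=> [[[Vz ?] Bz] [Aphi Vphi]].
Qed.

End occupation.

(** * The balance equation for a negative test function increasing along orbits *)

Section balance.
Context {R : realType} {M : model R}.
Hypothesis Hcompact : compactness_continuity M.
Local Notation lambda := (@lebesgue_measure R).
Local Notation impulse_space := (borel (X M) * \bar R * borel (action M))%type.
Local Notation aggregated_space := (borel (X M) * borel (adjoin (action M)))%type.
Variable mu : {finite_measure set impulse_space -> \bar R}.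
Hypothesis mu_active : mu.-negligible (~` (active M `*` setT)).
Hypothesis mueq : occupation_equation mu.
Variable eta : {measure set aggregated_space -> \bar R}.
Hypothesis eta_mu : aggregated_occupation_measure mu eta.
Variable w : X M -> R.
Hypothesis Hw : test_function w.
Hypothesis w_le0 : forall x, w x <= 0.
Hypothesis w_incr : forall x s t, 0 <= s -> s <= t -> w (phi x s) <= w (phi x t).
Local Open Scope ereal_scope.

Let started : set impulse_space :=
  V M `*` [set theta | (0 <= theta)%E] `*` setT.
Let impulsive : set impulse_space :=
  V M `*` [set theta | (0 <= theta < +oo)%E] `*` setT.
Let mstarted : measurable started := measurable_started Hcompact.
Let mimpulsive : measurable impulsive := measurable_impulsive Hcompact.

(** A finite active time is below [theta_star], the infimum of the times at which the orbit is
    outside [V]. *)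
Lemma active_post_flow (z : impulse_space) : active M z.1 -> impulsive z -> V M (post_flow z).
Proof.
case: z => -[x theta] a; rewrite /active/= => -[y [/= -> _ [[theta0 theta_lt]|->]]]; last first.
  by move=> [[_ /= /andP[]]].
move=> [[_ /= /andP[_ thetaoo]] _]; rewrite /post_flow/=.
apply: contrapT => nV; move: theta_lt; rewrite ltNge => /negP; apply.
apply: ereal_inf_lbound; exists (fine theta); last by rewrite fineK// ge0_fin_numE.
by split => //; exact: fine_ge0.
Qed.

(** Patching by [impulsive] makes the second term 0 at an infinite time, which merges the finite and
    infinite forms of the integral of [chi w]. *)
Lemma flow_balance (z : impulse_space) : started z ->
  \int[lambda]_(u in [set u : R | (0 <= u)%R /\ u%:E <= z.1.2]) (chi w (phi z.1.1 u))%:E +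
  ((fun z => (- w (post_flow z))%:E) \_ impulsive) z = (- w z.1.1)%:E.
Proof.
case: z => -[x [theta| |]] a [[/= Vx theta0] _] //.
  rewrite (_ : [set u | _] = `[0%R, theta]%classic); last first.
    by apply/seteqP; split => u /=; rewrite in_itv/= lee_fin; [move=> [-> ->]|move=> /andP[]].
  rewrite lee_fin in theta0.
  rewrite patchE mem_set; last by split => //; split => //=; rewrite lee_fin theta0 ltry.
  by rewrite (chi_integral Hcompact)// -EFinD/post_flow/=; congr EFin; ring.
rewrite (_ : [set u | _] = `[0%R, +oo[%classic); last first.
  by apply/seteqP; split => u /=; rewrite in_itv/= andbT leey; [move=> []|split].
rewrite (chi_integraly Hcompact)// patchE memNset ?adde0//.
by move=> [[_ /= /andP[_]]]; rewrite ltxx.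
Qed.

Lemma measurable_test : measurable_fun setT (w : borel (X M) -> R).
Proof. exact: test_measurable Hw. Qed.

Lemma balance :
  [/\ eta.-integrable (box_part (V M)) (fun p => (chi w p.1)%:E),
      eta.-integrable (action_part (V M) setT) (fun p => (w p.1)%:E),
      eta.-integrable (action_part (V M) setT) (fun p => (after_jump w p)%:E) &
      ((w (x0 M))%:E
       + \int[eta]_(p in box_part (V M)) (chi w p.1)%:E
       - \int[eta]_(p in action_part (V M) setT) (w p.1)%:E
       + \int[eta]_(p in action_part (V M) setT) (after_jump w p)%:E = 0)%E].
Proof.
have v0 x : 0 <= (- w x)%:E by rewrite lee_fin oppr_ge0.
have mv : measurable_fun setT ((fun x => (- w x)%:E) : borel (X M) -> \bar R).
  by apply/measurable_EFinP; apply: measurableT_comp => //; exact: measurable_test.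
have vV x : ~ V M x -> (- w x)%:E = 0 by move=> /(test_out Hw) ->; rewrite oppr0.
have c0 x : 0 <= (chi w x)%:E by rewrite lee_fin; exact: chi_ge0.
have mc : measurable_fun setT ((fun x => (chi w x)%:E) : borel (X M) -> \bar R).
  by apply/measurable_EFinP; exact: measurable_chi.
have cV x : ~ V M x -> (chi w x)%:E = 0 by move=> nV; rewrite (chi_out Hcompact).
(* With [- w] every integrand is nonnegative, so additivity and Tonelli apply before finiteness is
   known. *)
pose total := \int[mu]_(z in started) (- w z.1.1)%:E.
pose box := \int[eta]_(p in box_part (V M)) (chi w p.1)%:E.
pose act := \int[eta]_(p in action_part (V M) setT) (- w p.1)%:E.
pose jmp := \int[eta]_(p in action_part (V M) setT) (- after_jump w p)%:E.
have mpost : measurable_fun setT (fun z : impulse_space => (- w (post_flow z))%:E).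
  exact: (measurableT_comp mv (measurable_post_flow Hcompact)).
have actE : act = \int[mu]_(z in impulsive) (- w (post_flow z))%:E.
  rewrite /act (aggregated_action_integral Hcompact mu eta eta_mu (fun q => (- w q.1)%:E))//=.
    rewrite integral_mkcondr; apply: eq_integral => z _; rewrite patchE.
    by case: ifPn => // /negP; rewrite in_setE => /vV.
  exact: (measurableT_comp mv measurable_fst).
have boxactE : box + act = total.
  rewrite actE /box (aggregated_box_integral Hcompact mu eta eta_mu (fun x => (chi w x)%:E))//.
  rewrite -/started -(setIidr (_ : impulsive `<=` started)); last first.
    by move=> z [[Vz /andP[? _]] _]; split.
  rewrite (integral_mkcondr mu started impulsive).
  set inner := fun z : impulse_space => \int[lambda]_(u in _) _.
  have mpatch : measurable_fun started ((fun z => (- w (post_flow z))%:E) \_ impulsive).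
    apply: measurable_funTS; apply/(measurable_restrictT _ mimpulsive).
    exact: measurable_funTS.
  have minner : measurable_fun started inner.
    (* By [flow_balance] the inner integral is a difference of two measurable functions, the
       subtracted one being finite. *)
    apply: (@eq_measurable_fun _ _ _ _ _
      (fun z : impulse_space => ((- w z.1.1)%:E -
        ((fun z => (- w (post_flow z))%:E) \_ impulsive) z)%E)).
      move=> z; rewrite in_setE => sz; rewrite -(flow_balance _ sz) addeK//.
      by rewrite patchE; case: ifPn.
    apply: emeasurable_funB => //; apply: measurable_funTS.
    by apply: (measurableT_comp mv); exact: measurableT_comp.
  rewrite -ge0_integralD//; last 2 first.
  - by move=> z _; apply: integral_ge0 => u _; exact: c0.
  - by move=> z _; rewrite patchE; case: ifPn.
  by apply: eq_integral => z; rewrite in_setE => sz; rewrite flow_balance.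
have maj : measurable_fun setT
    ((fun q => (- w (jump q.1 q.2))%:E) : borel (X M) * borel (action M) -> \bar R).
  exact: (measurableT_comp mv measurable_jump).
have mact : measurable (action_part (V M) setT : set aggregated_space).
  by apply: measurable_action_part; exact: measurable_V.
have ajE (p : aggregated_space) : action_part (V M) setT p ->
    (- after_jump w p)%R = (- w (jump p.1 (odflt point p.2)))%R.
  by case: p => x [a|] [_ [b _]].
have mDf : measurable (impulsive `&` post_flow @^-1` V M).
  apply: measurableI => //; rewrite -[Z in measurable Z]setTI.
  by apply: measurable_post_flow => //; exact: measurable_V.
have jmpE : jmp = \int[mu]_(z in impulsive) (- w (post_jump z))%:E.
  rewrite /jmp; under eq_integral => p.
    rewrite in_setE => /ajE ->; over.
  rewrite /= (aggregated_action_integral Hcompact mu eta eta_mu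
    (fun q => (- w (jump q.1 q.2))%:E))//= -/impulsive.
  rewrite integral_mkcond [RHS]integral_mkcond.
  (* After a jump [w] need not vanish even if the state before it was outside [V]. The concentration
     of [mu] on [active] makes such impulses negligible. *)
  apply: ge0_ae_eq_integral => //.
  - apply/(measurable_restrictT _ mDf); apply: measurable_funTS.
    exact: (measurableT_comp mv (measurable_post_jump Hcompact)).
  - apply/(measurable_restrictT _ mimpulsive); apply: measurable_funTS.
    exact: (measurableT_comp mv (measurable_post_jump Hcompact)).
  - by move=> z _; apply: erestrict_ge0 => z' _; exact: v0.
  - by move=> z _; apply: erestrict_ge0 => z' _; exact: v0.
  apply: negligibleS mu_active => z /= /not_implyP[_ neq] [zact _]; apply: neq.
  rewrite !patchE; congr (if _ then _ else _); apply/idP/idP; rewrite !in_setE; first by move=> [].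
  by move=> zi; split => //; exact: active_post_flow.
have totalE : total = (- w (x0 M))%:E + jmp.
  by rewrite jmpE /total (occupation_equation_integral Hcompact mu (fun x => (- w x)%:E)).
(* [w] is bounded and [mu] is finite; the other three integrals are at most [total]. *)
have total_fin : total < +oo.
  have [K wK] := test_bounded Hw.
  apply: (@le_lt_trans _ _ (\int[mu]_(z in started) (cst K%:E) z)).
    apply: ge0_le_integral => //.
    - by apply: measurable_funTS; apply: (measurableT_comp mv); exact: measurableT_comp.
    - by move=> z _ /=; rewrite lee_fin; apply: le_trans (wK z.1.1); rewrite -normrN ler_norm.
  rewrite integral_cst//.
  by rewrite ltey_eq fin_numM// fin_num_measure.
have box0 : 0 <= box by apply: integral_ge0 => p _; exact: c0.
have act0 : 0 <= act by apply: integral_ge0 => p _; exact: v0.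
have jmp0 : 0 <= jmp by rewrite jmpE; apply: integral_ge0 => z _; exact: v0.
have box_fin : box < +oo by apply: le_lt_trans total_fin; rewrite -boxactE leeDl.
have act_fin : act < +oo by apply: le_lt_trans total_fin; rewrite -boxactE leeDr.
have jmp_fin : jmp < +oo by apply: le_lt_trans total_fin; rewrite totalE leeDr.
have mbox : measurable (box_part (V M) : set aggregated_space).
  by apply: measurable_box_part; exact: measurable_V.
have absN (x : R) : (x <= 0)%R -> `|x%:E| = (- x)%:E by move=> x0; rewrite abse_EFin ler0_norm.
have aj_le0 p : (after_jump w p <= 0)%R by rewrite /after_jump; case: p.2.
have mwE : measurable_fun setT (EFin \o w : borel (X M) -> \bar R).
  by apply/measurable_EFinP; exact: measurable_test.
have mj : measurable_fun setT
    ((fun p => (p.1, odflt point p.2)) : aggregated_space -> borel (X M) * borel (action M)).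
  apply: measurable_fun_pair => //; apply: measurableT_comp => //; exact: measurable_odflt.
have mjmp : measurable_fun (action_part (V M) setT : set aggregated_space)
    (fun p => (after_jump w p)%:E).
  apply: (@eq_measurable_fun _ _ _ _ _
    (fun p : aggregated_space => (w (jump p.1 (odflt point p.2)))%:E)).
    by move=> p; rewrite in_setE => /ajE/oppr_inj ->.
  apply: measurable_funTS.
  exact: (measurableT_comp mwE (measurableT_comp measurable_jump mj)).
split.
- apply/integrableP; split.
    by apply: measurable_funTS; exact: (measurableT_comp mc measurable_fst).
  by under eq_integral do rewrite gee0_abs//.
- apply/integrableP; split.
    by apply: measurable_funTS; exact: (measurableT_comp mwE measurable_fst).
  by under eq_integral do rewrite absN//.
- apply/integrableP; split; first exact: mjmp.
  by under eq_integral do rewrite absN//.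
have wactE : \int[eta]_(p in action_part (V M) setT) (w p.1)%:E = - act.
  rewrite /act -integral_ge0N => [|p _]; last exact: v0.
  by apply: eq_integral => p _; rewrite EFinN oppeK.
have wjmpE : \int[eta]_(p in action_part (V M) setT) (after_jump w p)%:E = - jmp.
  rewrite /jmp -integral_ge0N => [|p _]; last by rewrite lee_fin oppr_ge0.
  by apply: eq_integral => p _; rewrite EFinN oppeK.
rewrite wactE wjmpE -/box.
have real_of (y : \bar R) : 0 <= y -> y < +oo -> exists r, y = r%:E.
  by move=> y0 yoo; exists (fine y); rewrite fineK// ge0_fin_numE.
(* Both expressions of [total] are equated; all terms are now finite, so the conclusion is real
   arithmetic. *)
move: boxactE; rewrite totalE.
have [b ->] := real_of _ box0 box_fin; have [a ->] := real_of _ act0 act_fin.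
have [j ->] := real_of _ jmp0 jmp_fin.
rewrite -!EFinN -!EFinD => -[baj]; congr EFin; lra.
Qed.

End balance.

Theorem theorem4p1 (R : realType) (M : model R)
  (Hconsistency : consistency M)
  (Hcompact : compactness_continuity M)
  (Hcostly : costly_impulses M)
  (Horbit : orbit_condition M)
  (mu : {finite_measure set (borel (X M) * \bar R * borel (action M))%type -> \bar R})
  (mu_concentrated : mu.-negligible (~` (active M `*` setT)))
  (mu_equation : occupation_equation mu)
  (eta : {measure set (borel (X M) * borel (adjoin (action M)))%type -> \bar R})
  (eta_mu : aggregated_occupation_measure mu eta)
  (w : X M -> R) (Hw : test_function w) :
  [/\ eta.-integrable (box_part (V M)) (fun p => (chi w p.1)%:E),
      eta.-integrable (action_part (V M) setT) (fun p => (w p.1)%:E),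
      eta.-integrable (action_part (V M) setT) (fun p => (after_jump w p)%:E) &
      ((w (x0 M))%:E
       + \int[eta]_(p in box_part (V M)) (chi w p.1)%:E
       - \int[eta]_(p in action_part (V M) setT) (w p.1)%:E
       + \int[eta]_(p in action_part (V M) setT) (after_jump w p)%:E = 0)%E].
Proof.
have [[w_le0 w_incr]|[w_ge0 w_decr]] := test_monotone Hw.
  exact: (balance Hcompact mu mu_concentrated mu_equation eta eta_mu w Hw w_le0 w_incr).
(* For [w] positive and decreasing along orbits, [balance] is applied to its opposite. All four
   terms change sign, and integrability is preserved. *)
have HNw := test_functionN w Hw.
have Nw_le0 x : - w x <= 0 by rewrite oppr_le0.
have Nw_incr x s t : 0 <= s -> s <= t -> - w (phi x s) <= - w (phi x t).
  by move=> s0 st; rewrite lerN2; exact: w_decr.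
have [] := balance Hcompact mu mu_concentrated mu_equation eta eta_mu _ HNw Nw_le0 Nw_incr.
have chiE : (fun p : borel (X M) * borel (adjoin (action M)) => (chi (fun x => - w x) p.1)%:E) =
    (-%E \o (fun p => (chi w p.1)%:E))%E.
  by apply/funext => p /=; rewrite chiN.
have wE : (fun p : borel (X M) * borel (adjoin (action M)) => (- w p.1)%:E) =
    (-%E \o (fun p => (w p.1)%:E))%E by [].
have jE : (fun p : borel (X M) * borel (adjoin (action M)) =>
      (after_jump (fun x => - w x) p)%:E) = (-%E \o (fun p => (after_jump w p)%:E))%E.
  by apply/funext => p /=; rewrite /after_jump; case: p.2 => //; rewrite oppr0.
have mbox : measurable (box_part (V M) : set (borel (X M) * borel (adjoin (action M)))).
  by apply: measurable_box_part; exact: measurable_V.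
have mact : measurable (action_part (V M) setT : set (borel (X M) * borel (adjoin (action M)))).
  by apply: measurable_action_part; exact: measurable_V.
rewrite chiE wE jE => /integrableN i1 /integrableN i2 /integrableN i3 eq0.
have NN (f : borel (X M) * borel (adjoin (action M)) -> \bar R) :
  (-%E \o (-%E \o f) = f)%E by apply/funext => p /=; rewrite oppeK.
rewrite !NN in i1 i2 i3.
split => //; move: eq0.
rewrite /= !integralN ?integrable_add_def//.
rewrite -(fineK (integrable_fin_num mbox i1)) -(fineK (integrable_fin_num mact i2)).
rewrite -(fineK (integrable_fin_num mact i3)) -!EFinN -!EFinD => -[eq0].
by congr EFin; lra.
Qed.
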